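(* Let $X$ be a Banach space, let $T$ be a non-nilpotent bounded linear operator on $X$, and let $0<p<\infty$. If $T$ is $p$-absolutely Cesàro bounded, then $$\sup_{n\ge1}\ \frac1n\sum_{k=0}^{n-1}\frac{\|T^{n-1}\|^p}{\|T^k\|^p}\le C_{p,\mathrm{ac}}(T).$$
   Context: A bounded linear operator $T$ on a Banach space $X$ is $p$-absolutely Cesàro bounded ($p>0$) if there is $C>0$ with $\sup_{n\ge1}\frac1n\sum_{k=0}^{n-1}\|T^kx\|^p\le C\|x\|^p$ for all $x\in X$; $C_{p,\mathrm{ac}}(T)$ is the smallest such constant. $T$ is non-nilpotent if $T^n\neq0$ for every $n\ge 1$. *)

(* Defs.v *)
From HB Require Import structures.
From mathcomp Require Import all_boot all_order all_algebra.
From mathcomp Require Import all_classical all_reals all_analysis.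
From mathcomp Require Import complex.

Set Implicit Arguments.
Unset Strict Implicit.
Unset Printing Implicit Defensive.

Import Order.TTheory GRing.Theory Num.Theory.
Import numFieldNormedType.Exports.

Local Open Scope classical_set_scope.
Local Open Scope ring_scope.

(* A Banach space is real or complex: [completeNormedModType (scalar_field R s)] with
   [s] either [RealScalars] or [ComplexScalars]. *)
Variant scalars := RealScalars | ComplexScalars.

Definition scalar_field (R : realType) (s : scalars) : numFieldType :=
  match s with
  | RealScalars => R
  | ComplexScalars => R[i]
  end.

Definition re_scalar (R : realType) (s : scalars) : scalar_field R s -> R :=
  match s with
  | RealScalars => id
  | ComplexScalars => @complex.Re R
  end.

(* The norm of a normed module over [K] takes its values in [K], so over [R[i]]
   the real number it represents has to be extracted. *)
Definition rnorm (R : realType) (s : scalars)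
    (X : normedModType (scalar_field R s)) (x : X) : R :=
  re_scalar `|x|.

Definition opnorm (R : realType) (s : scalars)
    (X : normedModType (scalar_field R s)) (f : X -> X) : R :=
  sup [set rnorm (f x) | x in [set x : X | rnorm x <= 1]].

Definition sup_ge1 (R : realType) (u : nat -> R) : \bar R :=
  ereal_sup [set (u n)%:E | n in [set n : nat | (1 <= n)%N]].

Definition ac_constant (R : realType) (s : scalars)
    (X : normedModType (scalar_field R s)) (p : R) (T : X -> X) (C : R) : Prop :=
  0 < C /\
  forall x : X,
    (sup_ge1 (fun n => n%:R^-1 * \sum_(0 <= k < n) rnorm (iter k T x) `^ p)%R
      <= (C * rnorm x `^ p)%:E)%E.

Definition abs_Cesaro_bounded (R : realType) (s : scalars)
    (X : normedModType (scalar_field R s)) (p : R) (T : X -> X) : Prop :=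
  exists C : R, ac_constant p T C.

(* When [X] is nonzero and an admissible constant exists, the infimum is attained,
   so it is the smallest admissible constant. *)
Definition ac_best_constant (R : realType) (s : scalars)
    (X : normedModType (scalar_field R s)) (p : R) (T : X -> X) : R :=
  inf [set C : R | ac_constant p T C].

Definition non_nilpotent (R : realType) (s : scalars)
    (X : normedModType (scalar_field R s)) (T : X -> X) : Prop :=
  forall n : nat, (1 <= n)%N -> iter n T <> (fun=> 0).

(* Main.v *)
(* For a unit vector x and 0 <= k < n, submultiplicativity gives
   ||T^(n-1) x|| / ||T^(n-1-k)|| <= ||T^k x||.  Averaging the p-th powers over k
   and taking the supremum over x bounds the mean of the ratios
   ||T^(n-1)||^p / ||T^(n-1-k)||^p by any admissible constant C; reindexing
   k -> n-1-k gives the claim. *)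
Require Import Defs.
From HB Require Import structures.
From mathcomp Require Import all_boot all_order all_algebra.
From mathcomp Require Import all_classical all_reals all_analysis.
From mathcomp Require Import complex.

Set Implicit Arguments.
Unset Strict Implicit.
Unset Printing Implicit Defensive.

Import Order.TTheory GRing.Theory Num.Theory.
Import numFieldNormedType.Exports.

Local Open Scope classical_set_scope.
Local Open Scope ring_scope.

(** A section of [re_scalar], so that vectors can be rescaled by a real number over either field. *)
Definition real_scalar (R : realType) (s : scalars) : R -> scalar_field R s :=
  match s with
  | RealScalars => id
  | ComplexScalars => real_complex R
  end.

Section scalar_field.
Context {R : realType} {s : scalars}.
Implicit Types (r : R) (a b : scalar_field R s).

Lemma real_scalarK : cancel (@real_scalar R s) (@re_scalar R s).
Proof. by case: s. Qed.

Lemma re_scalarK a : 0 <= a -> real_scalar s (re_scalar a) = a.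
Proof. by case: s a => //= a a0; apply: RRe_real; rewrite ger0_real. Qed.

Lemma real_scalar_ge0 r : 0 <= r -> 0 <= real_scalar s r.
Proof. by case: s => //= r0; rewrite lecR. Qed.

Lemma le_re_scalar a b : a <= b -> re_scalar a <= re_scalar b.
Proof. by case: s a b => //= a b; rewrite lecE => /andP[]. Qed.

Lemma real_scalarM r r' :
  real_scalar s (r * r') = real_scalar s r * real_scalar s r'.
Proof. by case: s => //=; rewrite rmorphM. Qed.

Lemma re_scalar0 : re_scalar (0 : scalar_field R s) = 0.
Proof. by case: s. Qed.

Lemma re_scalarM a b : 0 <= a -> 0 <= b ->
  re_scalar (a * b) = re_scalar a * re_scalar b.
Proof.
by move=> a0 b0; rewrite -[in LHS](re_scalarK a0) -[in LHS](re_scalarK b0)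
  -real_scalarM real_scalarK.
Qed.

End scalar_field.

Section rnorm.
Context {R : realType} {s : scalars} {X : normedModType (scalar_field R s)}.
Implicit Types (x : X) (f : X -> X) (T : {linear X -> X}).

Lemma rnorm_ge0 x : 0 <= rnorm x.
Proof. by rewrite -(@re_scalar0 R s); exact/le_re_scalar/normr_ge0. Qed.

Lemma rnorm0 : rnorm (0 : X) = 0.
Proof. by rewrite /rnorm normr0 re_scalar0. Qed.

Lemma rnorm_eq0 x : rnorm x = 0 -> x = 0.
Proof.
move=> x0; apply/eqP; rewrite -normr_eq0 -(re_scalarK (normr_ge0 x)).
by rewrite -/(rnorm x) x0 -(@re_scalar0 R s) re_scalarK.
Qed.

Lemma rnormZ (r : R) x : 0 <= r -> rnorm (real_scalar s r *: x) = r * rnorm x.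
Proof.
move=> r0; rewrite /rnorm normrZ re_scalarM //.
by rewrite ger0_norm ?real_scalar_ge0// real_scalarK.
Qed.

(** The bound by [M] makes the set defining [opnorm f] bounded above, so its [sup] dominates the
    value of [f] at the normalised vector [x / rnorm x]. *)
Lemma rnorm_le_opnorm f (M : R) x : scalable f ->
  (forall y, rnorm (f y) <= M * rnorm y) -> rnorm (f x) <= opnorm f * rnorm x.
Proof.
move=> fZ fM; have [x0|x0] := eqVneq (rnorm x) 0.
  by rewrite x0 mulr0 (le_trans (fM x))// x0 mulr0.
have {x0}x_gt0 : 0 < rnorm x by rewrite lt_def x0 rnorm_ge0.
have ub : has_ubound [set rnorm (f y) | y in [set y : X | rnorm y <= 1]].
  (* [M] carries no sign, so its absolute value is the bound on the unit ball. *)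
  exists `|M| => _ [y /= y1 <-]; apply: (le_trans (fM y)).
  apply: le_trans (ler_wpM2r (rnorm_ge0 y) (ler_norm M)) _.
  exact: ler_piMr.
have V0 : 0 <= (rnorm x)^-1 by rewrite invr_ge0 ltW.
rewrite -ler_pdivrMr// mulrC -rnormZ// -fZ.
apply: ub_le_sup => //; exists (real_scalar s (rnorm x)^-1 *: x) => //=.
by rewrite rnormZ// mulVf// gt_eqF.
Qed.

Lemma opnorm_ge0 f : 0 <= opnorm f.
Proof.
rewrite /opnorm; set A := [set _ | _ in _].
(* If the set has no supremum, [sup] takes its default value 0. *)
have [Asup|/sup_out->//] := pselect (has_sup A).
apply: le_trans (rnorm_ge0 (f 0)) (ub_le_sup Asup.2 _).
by exists 0 => //=; rewrite rnorm0.
Qed.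

Lemma opnorm_gt0 f (M : R) : scalable f ->
  (forall y, rnorm (f y) <= M * rnorm y) -> f <> (fun=> 0) -> 0 < opnorm f.
Proof.
move=> fZ fM f_neq0; rewrite lt_def opnorm_ge0 andbT; apply/eqP => f0.
apply: f_neq0; apply/funext => x; apply: rnorm_eq0.
apply/eqP; rewrite eq_le rnorm_ge0 andbT.
by rewrite (le_trans (rnorm_le_opnorm x fZ fM))// f0 mul0r.
Qed.

(** Taking [p]-th roots is monotone, so [D] to the power [1/p] bounds [rnorm (f x)] on the unit
    ball, hence also the supremum. *)
Lemma opnorm_powR_le f (p D : R) : 0 < p ->
  (forall x, rnorm x <= 1 -> rnorm (f x) `^ p <= D) -> opnorm f `^ p <= D.
Proof.
move=> p0 fD.
have D0 : 0 <= D by apply: le_trans (fD 0 _); rewrite ?powR_ge0// rnorm0.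
rewrite -[leRHS]powRr1// -(mulVf (lt0r_neq0 p0)) powRrM.
apply: ge0_ler_powR; rewrite ?nnegrE ?(ltW p0) ?opnorm_ge0 ?powR_ge0//.
apply: ge_sup => [|_ [x /= x1 <-]].
  by exists (rnorm (f 0)), 0 => //=; rewrite rnorm0.
rewrite -[leLHS]powRr1 ?rnorm_ge0// -(divff (lt0r_neq0 p0)) powRrM.
apply: ge0_ler_powR; rewrite ?nnegrE ?powR_ge0 ?fD//.
by rewrite invr_ge0 ltW.
Qed.

Lemma bounded_near_rnorm T : bounded_near T (nbhs (0 : X)) ->
  exists2 M : R, 0 <= M & forall x, rnorm (T x) <= M * rnorm x.
Proof.
move=> /linear_boundedP /pinfty_ex_gt0[M M0 TM].
exists (re_scalar M) => [|x].
  by rewrite -(@re_scalar0 R s); exact/le_re_scalar/ltW.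
by rewrite /rnorm -re_scalarM ?(ltW M0)//; exact: le_re_scalar.
Qed.

Lemma iter_scalable T k : scalable (iter k T).
Proof. by elim: k => [|k IH] a x //=; rewrite IH linearZ. Qed.

Lemma rnorm_iter_le T (M : R) k x : 0 <= M ->
  (forall y, rnorm (T y) <= M * rnorm y) ->
  rnorm (iter k T x) <= M ^+ k * rnorm x.
Proof.
move=> M0 TM; elim: k => [|k IH]; first by rewrite expr0 mul1r.
by rewrite iterS (le_trans (TM _))// exprS -mulrA ler_wpM2l.
Qed.

Lemma iter_neq0 T k : non_nilpotent T -> iter k T <> (fun=> 0).
Proof.
case: k => [|k] TN; last exact: TN.
(* For exponent 0 the identity would vanish, so [X] would be trivial and [T] itself zero. *)
move=> T0; apply: (TN 1%N isT); apply/funext => x /=.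
by rewrite [x](congr1 (@^~ x) T0) linear0.
Qed.

End rnorm.

Lemma mean_opnorm_ratio_le (R : realType) (s : scalars)
    (X : normedModType (scalar_field R s)) (T : {linear X -> X}) (p C : R)
    (n : nat) :
  bounded_near T (nbhs (0 : X)) -> non_nilpotent T -> 0 < p ->
  ac_constant p T C -> (1 <= n)%N ->
  n%:R^-1 * \sum_(0 <= k < n) opnorm (iter n.-1 T) `^ p / opnorm (iter k T) `^ p
    <= C.
Proof.
move=> /bounded_near_rnorm[M M0 TM] TN p0 [C0 TC] n1.
have itM k x : rnorm (iter k T x) <= M ^+ k * rnorm x by exact: rnorm_iter_le.
have it_gt0 k : 0 < opnorm (iter k T) `^ p.
  apply: powR_gt0; apply: (opnorm_gt0 _ (itM k)); first exact: iter_scalable.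
  exact: iter_neq0.
set A := \sum_(0 <= k < n) (opnorm (iter k T) `^ p)^-1.
have A0 : 0 < A.
  rewrite /A big_ltn// ltr_pwDl ?invr_gt0//.
  by apply: sumr_ge0 => k _; rewrite invr_ge0 ltW.
have n0 : 0 < n%:R :> R by rewrite ltr0n.
rewrite -mulr_sumr -/A ler_pdivrMl// -ler_pdivlMr//.
apply: opnorm_powR_le => // x x1; rewrite ler_pdivlMr//.
have xC : rnorm x `^ p <= 1.
  rewrite -[leRHS]/((fun=> 1) p) -powR1.
  by rewrite ge0_ler_powR ?nnegrE ?rnorm_ge0 ?ler01 ?(ltW p0).
(* The intermediate sum is [n] times the Cesàro mean at [x], hence at most [n%:R * C] because
   [rnorm x <= 1]. *)
apply: (@le_trans _ _ (\sum_(0 <= k < n) rnorm (iter k T x) `^ p)); last first.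
  rewrite -ler_pdivrMl//; apply: (@le_trans _ _ (C * rnorm x `^ p)).
    by rewrite -lee_fin; apply: le_trans (TC x); apply: ereal_sup_ubound; exists n.
  by rewrite ler_piMr// ltW.
(* After reversal, the norm of [iter k T] is paired with the orbit point of index [n - k.+1], and
   the two exponents add up to [n.-1]. *)
rewrite [leRHS]big_nat_rev /A mulr_sumr !big_nat; apply: ler_sum => k kn.
rewrite add0n ler_pdivrMr// -powRM ?rnorm_ge0 ?opnorm_ge0//.
apply: ge0_ler_powR; rewrite ?nnegrE ?mulr_ge0 ?rnorm_ge0 ?opnorm_ge0 ?(ltW p0)//.
have -> : n.-1 = (k + (n - k.+1))%N.
  by case/andP: kn => _ kn; rewrite -[in LHS](subnKC kn).
by rewrite iterD mulrC; exact: rnorm_le_opnorm (iter_scalable T k) (itM k).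
Qed.

Theorem proposition3p15 (R : realType) (s : scalars)
    (X : completeNormedModType (scalar_field R s)) (T : {linear X -> X}) (p : R)
    (T_bounded : bounded_near T (nbhs (0 : X)))
    (T_non_nilpotent : non_nilpotent T)
    (p_gt0 : 0 < p)
    (T_acb : abs_Cesaro_bounded p T) :
  (sup_ge1 (fun n => n%:R^-1 *
     \sum_(0 <= k < n) opnorm (iter n.-1 T) `^ p / opnorm (iter k T) `^ p)%R
   <= (ac_best_constant p T)%:E)%E.
Proof.
apply: ge_ereal_sup => _ [n /= n1 <-]; rewrite lee_fin.
(* [T_acb] makes the set of admissible constants nonempty, so its [inf] is a genuine infimum, and
   each mean is a lower bound of that set. *)
apply: lb_le_inf => [//|C TC]; exact: mean_opnorm_ratio_le.
Qed.
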